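(* Let $n\ge 1$, let $\mathcal{S}$ be a Sperner family in $\{1,\dots,n\}$, and let $H=H_{\mathcal{S}}:\mathbb{R}^n\to\mathbb{R}$ be the associated Sperner statistic. Assume that $H$ is not a projection $(x_1,\dots,x_n)\mapsto x_j$ onto a single coordinate, and let $\omega_H\in[0,1]$ be the Sperner point of $H$. Then for any (real-valued) random variable $X$, $$\mathbf{H}^{(N)}(X)\ \longrightarrow\ Q_X(\omega_H)\quad\text{in distribution as } N\to\infty.$$
   Context: Sperner statistics: a Sperner family in $\{1,\dots,n\}$ is a collection $\mathcal{S}=\{A_1,\dots,A_k\}$, $k\ge1$, of nonempty subsets of $\{1,\dots,n\}$ such that no $A_i$ is contained in another $A_j$. Its Sperner statistic is $H_{\mathcal{S}}(x_1,\dots,x_n)=\max_{1\le j\le k}\min_{i\in A_j}x_i$. There is a polynomial $h=h_{\mathcal{S}}$ (the module of $H_{\mathcal S}$), namely $h(t)=\sum_{I\subseteq\{1,\dots,k\}}(-1)^{|I|}(1-t)^{|\bigcup_{i\in I}A_i|}$, such that for every random variable $X$ and independent copies $X_1,\dots,X_n$ of $X$, $\mathbf{P}(H_{\mathcal{S}}(X_1,\dots,X_n)\le t)=h(\mathbf{P}(X\le t))$ for all $t\in\mathbb{R}$. $H_{\mathcal S}$ is a projection exactly when $\mathcal{S}$ consists of just one singleton. Sperner point $\omega_H$ (for $H=H_{\mathcal{S}}$ not a projection): if $\mathcal{S}$ contains a singleton and $\bigcap_{j}A_j=\emptyset$ (then $h(x)<x$ on $(0,1)$), $\omega_H=1$;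 if $\mathcal{S}$ contains no singleton and $\bigcap_jA_j\ne\emptyset$ (then $h(x)>x$ on $(0,1)$), $\omega_H=0$; in the remaining case (every $|A_j|\ge2$ and $\bigcap_jA_j=\emptyset$) $\omega_H$ is the unique fixed point of $h$ in $(0,1)$. Iterates: $\mathbf{H}(X)=H(X_1,\dots,X_n)$ with $X_j$ independent copies of $X$ (defined up to equality in distribution); $\mathbf{H}^{(1)}=\mathbf{H}$ and $\mathbf{H}^{(N)}(X)=\mathbf{H}(\mathbf{H}^{(N-1)}(X))$ for $N\ge2$, where independent copies are taken at each step. Quantiles: let $F_X$ be the distribution function of $X$. For $\eta\in(0,1)$ put $a_X(\eta)=\inf\{t\in\mathbb{R}:F_X(t)\ge\eta\}$ and $z_X(\eta)=\inf\{t\in\mathbb{R}:F_X(t)>\eta\}$; then $Q_X(\eta)$ is the random variable taking the value $a_X(\eta)$ with probability $\eta$ and the value $z_X(\eta)$ with probability $1-\eta$ (a constant if $a_X(\eta)=z_X(\eta)$). Also $Q_X(0)=\inf\{t:F_X(t)>0\}$ and $Q_X(1)=\sup\{t:F_X(t)<1\}$ are constants, possibly $-\infty$ and $+\infty$ respectively. When the limit is $\pm\infty$, convergence in distribution is understood on the extended real line $[-\infty,+\infty]$ (i.e. $\mathbf{P}(\mathbf{H}^{(N)}(X)\le t)\to0$ for all real $t$ if the limit is $+\infty$, and $\to1$ for all real $t$ if the limit is $-\infty$). *)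

(* Defs.v *)
From HB Require Import structures.
From mathcomp Require Import all_boot all_order all_algebra.
From mathcomp Require Import all_classical all_reals all_analysis.
From mathcomp Require Import measurable_realfun.

Set Implicit Arguments.
Unset Strict Implicit.
Unset Printing Implicit Defensive.

Import Order.TTheory GRing.Theory Num.Theory.
Import numFieldNormedType.Exports.

Local Open Scope classical_set_scope.
Local Open Scope ring_scope.

(** ** Sperner families and Sperner statistics *)

(* The ground set {1, ..., n} is rendered as 'I_n. *)
Definition sperner_family n (S : {set {set 'I_n}}) : Prop :=
  [/\ S != finset.set0, finset.set0 \notin S
    & forall A B : {set 'I_n},
        A \in S -> B \in S -> A \subset B -> A = B].

(* max over A in S of min over i in A of x_i. The bounds -oo and +oo only
   initialise the iterated operations: the value is finite, hence not altered
   by [fine], as soon as S and all its members are nonempty. *)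
Definition sperner_stat (R : realType) n (S : {set {set 'I_n}})
    (x : n.-tuple R) : R :=
  fine (\big[maxe/-oo%E]_(A in S) \big[mine/+oo%E]_(i in A) (tnth x i)%:E).

Definition is_projection (R : realType) n (H : n.-tuple R -> R) : Prop :=
  exists j : 'I_n, forall x : n.-tuple R, H x = tnth x j.

Definition sperner_module (R : realType) n (S : {set {set 'I_n}}) : {poly R} :=
  \sum_(I : {set {set 'I_n}} | I \subset S)
    (-1) ^+ #|I| * (1 - 'X) ^+ #|finset.cover I|.

Definition has_singleton n (S : {set {set 'I_n}}) : bool :=
  [exists A in S, #|A| == 1%N].

Definition common_part n (S : {set {set 'I_n}}) : {set 'I_n} :=
  (\bigcap_(A in S) A)%SET.

(* Meaningful when the statistic of S is not a projection: [has_singleton S]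
   and [common_part S != set0] then do not hold together. In the last case the
   fixed point of the module in (0, 1) exists and is unique. *)
Definition sperner_point (R : realType) n (S : {set {set 'I_n}}) : R :=
  if has_singleton S && (common_part S == finset.set0) then 1
  else if ~~ has_singleton S && (common_part S != finset.set0) then 0
  else get [set w : R | 0 < w < 1 /\ (sperner_module R S).[w] = w].

Section sperner_stat_measurable.
Context {R : realType} {n : nat}.
Implicit Type S : {set {set 'I_n}}.

Fact measurable_min (A : {set 'I_n}) : measurable_fun [set: n.-tuple R]
  (fun x => \big[mine/+oo%E]_(i in A) (tnth x i)%:E).
Proof.
rewrite unlock; elim: (index_enum _) => [|i r IHr] /=.
  exact: measurable_cst.
case: (i \in A) => //=; apply: measurable_mine => //.
by apply/measurable_EFinP; exact: measurable_tnth.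
Qed.

Fact measurable_max_min S : measurable_fun [set: n.-tuple R]
  (fun x => \big[maxe/-oo%E]_(A in S) \big[mine/+oo%E]_(i in A) (tnth x i)%:E).
Proof.
pose m (A : {set 'I_n}) (x : n.-tuple R) :=
  \big[mine/+oo%E]_(i in A) (tnth x i)%:E.
suff : measurable_fun [set: n.-tuple R]
  (fun x => \big[maxe/-oo%E]_(A in S) m A x) by [].
rewrite unlock.
elim: (index_enum _) => [|A s IH] /=; first exact: measurable_cst.
by case: (A \in S) => //=; apply: measurable_maxe => //;
  exact: (measurable_min A).
Qed.

Fact measurable_sperner_stat S :
  measurable_fun [set: n.-tuple R] (@sperner_stat R n S).
Proof. exact: measurableT_comp (measurable_max_min S). Qed.

HB.instance Definition _ S := isMeasurableFun.Build _ _ _ _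
  (@sperner_stat R n S) (measurable_sperner_stat S).

End sperner_stat_measurable.

(** ** Independent copies and iteration *)

Section product_probability.
Context {R : realType} {d1 d2 : measure_display}.
Context {T1 : measurableType d1} {T2 : measurableType d2}.
Variables (P1 : probability T1 R) (P2 : probability T2 R).
Local Open Scope ereal_scope.

Fact product_setT : (P1 \x P2) [set: T1 * T2] = 1.
Proof.
rewrite -setXTT; transitivity (P1 [set: T1] * P2 [set: T2]).
  exact: product_measure1E.
by rewrite !probability_setT mule1.
Qed.

HB.instance Definition _ :=
  Measure_isProbability.Build _ _ _ (P1 \x P2) product_setT.

End product_probability.

Section consp.
Context {d : measure_display} {T : measurableType d} {n : nat}.

Definition consp (xy : T * n.-tuple T) : n.+1.-tuple T :=
  cons_tuple xy.1 xy.2.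

Fact measurable_consp : measurable_fun [set: T * n.-tuple T] consp.
Proof.
exact: (@measurable_cons _ _ _ _ fst n snd measurable_fst measurable_snd).
Qed.

HB.instance Definition _ :=
  isMeasurableFun.Build _ _ _ _ consp measurable_consp.

End consp.

Section iid.
Context {R : realType} {d : measure_display} {T : measurableType d}.
Local Open Scope ereal_scope.

(* The n-fold product law P x ... x P: under it the n coordinates are
   independent copies of a random variable of law P (see [iid_lawE]). *)
Fixpoint iid_law (P : probability T R) n : probability (n.-tuple T) R :=
  match n with
  | 0 => \d_[tuple]
  | m.+1 => distribution (P \x iid_law P m) consp
  end.

Lemma iid_lawE (P : probability T R) n (B : 'I_n -> set T) :
  (forall i, measurable (B i)) ->
  iid_law P n [set x | forall i, B i (tnth x i)] = \prod_(i < n) P (B i).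
Proof.
elim: n B => [|n IH] B mB.
  by rewrite big_ord0 /= diracE mem_set//= => -[].
pose C := [set y : n.-tuple T | forall i : 'I_n, B (lift ord0 i) (tnth y i)].
have mC : measurable C.
  rewrite (_ : C = \bigcap_(i in [set: 'I_n])
      (fun y : n.-tuple T => tnth y i) @^-1` B (lift ord0 i)); last first.
    by apply/seteqP; split=> [y yC i _|y yC i]; exact: yC.
  apply: fin_bigcap_measurable => // i _; rewrite -[X in measurable X]setTI.
  exact: measurable_tnth.
rewrite big_ord_recl -(IH (fun i => B (lift ord0 i)))// -/C.
rewrite -product_measure1E//= /distribution /pushforward.
congr (product_measure1 _ _ _).
apply/seteqP; split=> [[a y] /= h|[a y] /= [h0 h] i].
  by split=> [|i]; [exact: (h ord0)|have := h (lift ord0 i); rewrite tnthS].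
by case: (unliftP ord0 i) => [j|] ->; rewrite ?tnthS ?tnth0.
Qed.

End iid.

(* The law of H(X_1, ..., X_n) for independent copies X_1, ..., X_n of a random
   variable of law mu, and the law of its N-fold iterate (N = 0 gives mu). *)
Definition sperner_law (R : realType) n (S : {set {set 'I_n}})
    (mu : probability R R) : probability R R :=
  distribution (iid_law mu n) (@sperner_stat R n S).

Definition sperner_iter (R : realType) n (S : {set {set 'I_n}}) (N : nat)
    (mu : probability R R) : probability R R :=
  iter N (sperner_law S) mu.

(** ** Quantiles *)

Section quantile.
Context {R : realType} {d : measure_display} {T : measurableType d}
  {P : probability T R}.
Implicit Types (X : {RV P >-> R}) (eta : R).
Local Open Scope ereal_scope.

Definition lower_quantile X eta : \bar R :=
  ereal_inf [set t%:E | t in [set t : R | eta%:E <= cdf X t]].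

Definition upper_quantile X eta : \bar R :=
  ereal_inf [set t%:E | t in [set t : R | eta%:E < cdf X t]].

Definition ess_infimum X : \bar R :=
  ereal_inf [set t%:E | t in [set t : R | 0 < cdf X t]].

Definition ess_supremum X : \bar R :=
  ereal_sup [set t%:E | t in [set t : R | cdf X t < 1]].

(* Q_X(eta) as a random variable on the two-point space [bool] endowed with the
   Bernoulli law of parameter eta, under which [true] has probability eta. *)
Definition quantile_var X eta (b : bool) : \bar R :=
  if eta == 0%R then ess_infimum X
  else if eta == 1%R then ess_supremum X
  else if b then lower_quantile X eta else upper_quantile X eta.

Fact measurable_quantile_var X eta :
  measurable_fun [set: bool] (quantile_var X eta).
Proof. by []. Qed.

HB.instance Definition _ X eta := isMeasurableFun.Build _ _ _ _
  (quantile_var X eta) (@measurable_quantile_var X eta).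

Definition quantile_law X eta : probability (\bar R) R :=
  distribution (bernoulli_prob eta) (quantile_var X eta).

End quantile.

(** ** Convergence in distribution on the extended real line *)

Definition ext_cdf (R : realType) (nu : probability (\bar R) R) (t : R) :
  \bar R := nu [set y | (y <= t%:E)%E].

(* The limit law lives on [-oo, +oo] and may charge -oo and +oo: the real
   distribution functions converge at every real continuity point of the
   limiting one. *)
Definition cvg_in_distribution (R : realType) (mu : nat -> probability R R)
    (nu : probability (\bar R) R) : Prop :=
  forall t : R, {for t, continuous (ext_cdf nu)} ->
    mu N `]-oo, t]%classic @[N --> \oo] --> ext_cdf nu t.

(* Main.v *)
Require Import Defs.
From mathcomp Require Import all_boot all_order all_algebra.
From mathcomp Require Import all_classical all_reals all_analysis.
From mathcomp Require Import measurable_realfun.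
From mathcomp Require Import ring lra.

(** The event [H(x_1, ..., x_n) <= t] depends on [x] only through the bits
    [x_i <= t]: it says that every member [A] of [S] contains some [i] whose bit
    is set, an increasing boolean function of the bits ([hit], and
    [sperner_stat_le]). For independent copies these bits are independent
    Bernoulli variables of parameter [p = F(t)], so the distribution function of
    [H(X_1, ..., X_n)] at [t] is [h(p)], the probability of [hit] under
    parameter [p] ([iid_law_bits]), and inclusion-exclusion identifies [h] with
    the module of [S] ([sperner_moduleE]). Hence the distribution function of the
    [N]-th iterate at [t] is [h^N(F(t))] ([sperner_iterE]) and the theorem is
    about the dynamics of [h] on the interval [0, 1].

    The key is [odds_increase]: if a boolean function of the bits is increasing,
    and is neither constant nor equal to one of its bits, then the ratio of the
    odds of the function to the odds of one bit,
    [(h(p) / (1 - h(p))) / (p / (1 - p))], is strictly increasing in [p]. This is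
    an integrated form of the Moore-Shannon inequality
    [p (1 - p) h'(p) > h(p) (1 - h(p))]. It is proved by conditioning on the first
    bit: the two restrictions of the function satisfy the weak inequality by
    induction, and mixing them only helps, because the restriction to a set first
    bit is the larger one ([odds_mixture]).

    At a fixed point in (0, 1) the ratio equals 1, so [h(x) < x] to its left and
    [h(x) > x] to its right. When [S] has no singleton and no common point, such a
    fixed point exists: [hit] needs at least two set bits and its failure at
    least two unset bits, so [h] is quadratically small at 0 and [1 - h] at 1. In
    the two other cases [hit] implies one of the bits, or is implied by it, so
    that [h(x) <= x], respectively [h(x) >= x], throughout, and an interior fixed
    point would make [h] cross the diagonal there. In all cases the Sperner
    point [w] separates [h(x) < x] from [h(x) > x] ([sperner_point_spec]), and
    the iterates tend to 0 from the left of [w], to 1 from its right, and stay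
    at [w] ([iter_module_cvg]).

    The distribution function of [Q_X(w)] takes the corresponding values 0, 1
    and [w] wherever it is continuous, that is, away from the atoms of
    [Q_X(w)] ([ext_cdf_quantile]). *)

Set Implicit Arguments.
Unset Strict Implicit.
Unset Printing Implicit Defensive.

Import Order.TTheory GRing.Theory Num.Theory.
Import numFieldNormedType.Exports.

Local Open Scope classical_set_scope.
Local Open Scope ring_scope.

(** * Increasing boolean functions of independent bits *)

Section bernoulli_bits.
Variable R : realFieldType.
Implicit Types (p q : R) (f g : seq bool -> R) (phi psi : pred (seq bool)).

(** Expectation of [f] over [n] independent bits of parameter [p]. The bits are
    drawn one at a time, in the order in which [iid_law] draws coordinates, so
    that conditioning on the first bit is the recursion itself. *)
Fixpoint bexp n f p : R :=
  if n is m.+1 then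
    p * bexp m (f \o cons true) p + (1 - p) * bexp m (f \o cons false) p
  else f [::].

Definition bprob n phi p : R := bexp n (fun b => (phi b)%:R) p.

Lemma bprobS n phi p : bprob n.+1 phi p =
  p * bprob n (phi \o cons true) p + (1 - p) * bprob n (phi \o cons false) p.
Proof. by []. Qed.

Lemma eq_bexp n f g p : (forall b, size b = n -> f b = g b) ->
  bexp n f p = bexp n g p.
Proof.
elim: n f g => [|n IH] f g fg /=; first exact: fg.
by congr (_ * _ + _ * _); apply: IH => b bn /=; apply: fg; rewrite /= bn.
Qed.

Lemma bexp_sum n (I : Type) (r : seq I) (P : pred I)
    (F : I -> seq bool -> R) p :
  bexp n (fun b => \sum_(i <- r | P i) F i b) p =
  \sum_(i <- r | P i) bexp n (F i) p.
Proof.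
elim: n F => [|n IH] F //=.
rewrite (IH (fun i => F i \o cons true)) (IH (fun i => F i \o cons false)).
by rewrite !mulr_sumr -big_split.
Qed.

Lemma bexpZ n c f p : bexp n (fun b => c * f b) p = c * bexp n f p.
Proof.
elim: n f => [|n IH] f //=.
by rewrite (IH (f \o cons true)) (IH (f \o cons false)); ring.
Qed.

Lemma bexp_cst n c p : bexp n (fun=> c) p = c.
Proof. by elim: n => //= n IH; rewrite /comp IH; ring. Qed.

Lemma bexp_prod n (g : 'I_n -> bool -> R) p :
  bexp n (fun b => \prod_(i < n) g i (nth false b i)) p =
  \prod_(i < n) (p * g i true + (1 - p) * g i false).
Proof.
elim: n g => [|n IH] g /=; first by rewrite !big_ord0.
have E c : bexp n ((fun b => \prod_(i < n.+1) g i (nth false b i)) \o cons c) p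
    = g ord0 c * \prod_(i < n) (p * g (lift ord0 i) true +
                                (1 - p) * g (lift ord0 i) false).
  rewrite -(IH (fun i => g (lift ord0 i))) -bexpZ; apply: eq_bexp => b _ /=.
  by rewrite big_ord_recl /=.
by rewrite !E big_ord_recl; ring.
Qed.

Lemma bprob_itv n phi p : 0 <= p <= 1 -> 0 <= bprob n phi p <= 1.
Proof.
move=> /andP[p0 p1]; rewrite /bprob.
elim: n phi => [|n IH] phi /=; first by rewrite ler0n lern1 leq_b1.
have /andP[a0 a1] := IH (phi \o cons true).
by have /andP[b0 b1] := IH (phi \o cons false); apply/andP; split; nra.
Qed.

Lemma bprob_le n phi psi p : 0 <= p <= 1 -> (forall b, phi b -> psi b) ->
  bprob n phi p <= bprob n psi p.
Proof.
move=> p01; elim: n phi psi => [|n IH] phi psi le; rewrite /bprob /=.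
  by have := le [::]; case: (phi _) => [->//|_]; exact: ler0n.
by case/andP: p01 => p0 p1; apply: lerD; apply: ler_wpM2l;
  rewrite ?subr_ge0//; apply: IH => b; exact: le.
Qed.

(** For [0 < p < 1] every word has positive probability, so that nested events
    of equal probability coincide. *)
Lemma bprob_eq n phi psi p : 0 < p < 1 -> (forall b, phi b -> psi b) ->
  bprob n phi p = bprob n psi p -> forall b, size b = n -> phi b = psi b.
Proof.
move=> p01; have p01' : 0 <= p <= 1 by case/andP: p01 => *; rewrite !ltW.
elim: n phi psi => [|n IH] phi psi le.
  rewrite /bprob /= => /eqP; rewrite eqr_nat => + b /size0nil ->.
  by do 2 case: (_ [::]).
rewrite !bprobS => eq.
have le_c c : bprob n (phi \o cons c) p <= bprob n (psi \o cons c) p.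
  by apply: bprob_le => // b; exact: le.
have [Et Ef] : bprob n (phi \o cons true) p = bprob n (psi \o cons true) p /\
  bprob n (phi \o cons false) p = bprob n (psi \o cons false) p.
  have := le_c true; have := le_c false; case/andP: p01 => p0 p1 lf lt.
  split; nra.
by case=> [//|[] b [bn]]; [apply: (IH _ _ _ Et)|apply: (IH _ _ _ Ef)] => // c;
  exact: le.
Qed.

(** Exchanging the two values of each bit turns the parameter [p] into [1 - p];
    this carries estimates near 0 over to estimates near 1. *)
Lemma bprob_neg n phi p :
  bprob n (fun b => ~~ phi (map negb b)) (1 - p) = 1 - bprob n phi p.
Proof.
elim: n phi => [|n IH] phi; first by rewrite /bprob /=; case: phi;
  rewrite ?subr0 ?subrr.
rewrite !bprobS (IH (phi \o cons false)) (IH (phi \o cons true)); ring.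
Qed.

(** Union bound over the words of length [n]: one with at least [k] set bits has
    probability at most [p ^ k]. *)
Lemma bprob_count n phi p k : 0 <= p <= 1 ->
  (forall b, size b = n -> phi b -> (k <= count id b)%N) ->
  bprob n phi p <= 2 ^+ n * p ^+ k.
Proof.
move=> p01; have /andP[p0 p1] := p01.
elim: n phi k => [|n IH] phi k cnt.
  rewrite /bprob /= mul1r; have := cnt [::] erefl; case: (phi _) => h.
    by move: (h isT); rewrite leqn0 => /eqP ->.
  by rewrite exprn_ge0.
rewrite bprobS.
have ht : bprob n (phi \o cons true) p <= 2 ^+ n * p ^+ k.-1.
  apply: IH => b bn /cnt; rewrite /= bn => /(_ erefl).
  by case: k {cnt} => //= k; rewrite add1n.
have hf : bprob n (phi \o cons false) p <= 2 ^+ n * p ^+ k.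
  by apply: IH => b bn /cnt; rewrite /= bn; exact.
have pk : p * p ^+ k.-1 <= p ^+ k.
  by case: k {cnt ht hf} => [|k]; [rewrite mulr1|rewrite exprS].
have h2 : 0 <= (2 ^+ n : R) by rewrite exprn_ge0.
have hpk : 0 <= p ^+ k by rewrite exprn_ge0.
have /andP[v0 _] := bprob_itv n (phi \o cons false) p01.
rewrite exprS -mulrA mulr_natl mulr2n lerD//.
  apply: le_trans (ler_wpM2l p0 ht) _.
  by rewrite mulrCA ler_wpM2l.
by apply: le_trans hf; rewrite ler_piMl// lerBlDr lerDl.
Qed.

(** Bits beyond the end of a word count as unset, which makes the notion
    independent of the length and stable under fixing the first bit. *)
Definition monotone_bits phi := forall b c,
  (forall i, nth false b i -> nth false c i) -> phi b -> phi c.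

Lemma monotone_cons phi c : monotone_bits phi -> monotone_bits (phi \o cons c).
Proof. by move=> m b b' bb'; apply: m => -[|i] //=; exact: bb'. Qed.

Definition constant_on n phi := exists c, forall b, size b = n -> phi b = c.

Definition dictator_on n phi :=
  exists2 j, (j < n)%N & forall b, size b = n -> phi b = nth false b j.

Lemma bprob_dictator n j p : (j < n)%N ->
  bprob n (fun b => nth false b j) p = p.
Proof.
elim: n j => [//|n IH] [|j] jn; rewrite bprobS.
  by rewrite /bprob /comp /= !bexp_cst; ring.
by rewrite (IH j jn); ring.
Qed.

(** The step from [n] to [n + 1] bits: [a0], [a1] are the probabilities, at
    parameter [p], of the restrictions of an increasing function to an unset and a
    set first bit, and [b0], [b1] those at parameter [q]. Each hypothesis bounds
    [b_i] below by an increasing function of [a_i]; after this substitution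
    what remains is a product of nonnegative factors, one of which is
    [a1 - a0]. It vanishes for [a0 < a1] only if [a0 = 0] and [a1 = 1]. *)
Lemma odds_mixture p q a0 a1 b0 b1 : 0 < p -> p < q -> q < 1 ->
  0 <= a0 -> a0 < a1 -> a1 <= 1 -> 0 < a0 \/ a1 < 1 ->
  q * (1 - p) * (a0 * (1 - b0)) <= p * (1 - q) * (b0 * (1 - a0)) ->
  q * (1 - p) * (a1 * (1 - b1)) <= p * (1 - q) * (b1 * (1 - a1)) ->
  q * (1 - p) * ((p * a1 + (1 - p) * a0) * (1 - (q * b1 + (1 - q) * b0))) <
  p * (1 - q) * ((q * b1 + (1 - q) * b0) * (1 - (p * a1 + (1 - p) * a0))).
Proof.
move=> p0 pq q1 a00 a01 a11 nd h0 h1.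
set al := p * (1 - q) in h0 h1 *; set be := q * (1 - p) in h0 h1 *.
have al0 : 0 < al by rewrite /al; nra.
have albe : al < be by rewrite /al /be; nra.
have be0 : 0 < be by exact: lt_trans albe.
pose e0 := al * (1 - a0) + be * a0; pose e1 := al * (1 - a1) + be * a1.
have e00 : 0 < e0 by rewrite /e0; nra.
have e10 : 0 < e1 by rewrite /e1; nra.
have k0 : be * a0 <= b0 * e0 by rewrite /e0; nra.
have k1 : be * a1 <= b1 * e1 by rewrite /e1; nra.
(* X collects the terms that mix the two restrictions. *)
pose X := be * b1 * e0 + al * b0 * e1 - al * be * a1 - be ^+ 2 * a0.
have X0 : 0 < X.
  rewrite -(pmulr_rgt0 _ (mulr_gt0 e00 e10)).
  apply: (@lt_le_trans _ _
      (be * al * (a1 - a0) * (be - al) * (al * (1 - a1) + be * a0))).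
    apply: mulr_gt0; first by do !apply: mulr_gt0 => //; rewrite subr_gt0.
    by case: nd => ?; nra.
  (* The bound is the value of X * e0 * e1 when k0 and k1 are equalities. *)
  rewrite -subr_ge0.
  rewrite (_ : _ - _ = be * e0 ^+ 2 * (b1 * e1 - be * a1) +
                       al * e1 ^+ 2 * (b0 * e0 - be * a0)); last first.
    by rewrite /X /e0 /e1; ring.
  by rewrite addr_ge0// mulr_ge0 ?subr_ge0// mulr_ge0 ?sqr_ge0// ltW.
rewrite -subr_gt0.
rewrite (_ : _ - _ = p * q * (al * (b1 * (1 - a1)) - be * (a1 * (1 - b1)))
  + (1 - p) * (1 - q) * (al * (b0 * (1 - a0)) - be * (a0 * (1 - b0))) + X).
  rewrite ltr_wpDl// addr_ge0// mulr_ge0 ?subr_ge0//; nra.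
by rewrite /X /e0 /e1 /al /be; ring.
Qed.

(** Moore-Shannon inequality between two parameters, in the form obtained by
    clearing the denominators of
    [(h p / (1 - h p)) / (p / (1 - p)) < (h q / (1 - h q)) / (q / (1 - q))],
    which also makes sense when [h] takes the values 0 and 1. Both exceptional
    cases give an equality, so the weak inequality always holds and feeds the
    induction. *)
Lemma odds_increase n phi p q : monotone_bits phi -> 0 < p -> p < q -> q < 1 ->
  [\/ q * (1 - p) * (bprob n phi p * (1 - bprob n phi q)) <
      p * (1 - q) * (bprob n phi q * (1 - bprob n phi p)),
      constant_on n phi | dictator_on n phi].
Proof.
move=> + p0 pq q1.
have p01 : 0 < p < 1 by rewrite p0 (lt_trans pq).
have q01 : 0 < q < 1 by rewrite q1 (lt_trans p0).
have p01' : 0 <= p <= 1 by case/andP: p01 => *; rewrite !ltW.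
have q01' : 0 <= q <= 1 by case/andP: q01 => *; rewrite !ltW.
elim: n phi => [|n IH] phi mphi.
  by apply: Or32; exists (phi [::]) => b /size0nil ->.
pose phi1 := phi \o cons true; pose phi0 := phi \o cons false.
have m1 : monotone_bits phi1 by exact: monotone_cons.
have m0 : monotone_bits phi0 by exact: monotone_cons.
have weak psi : monotone_bits psi ->
    q * (1 - p) * (bprob n psi p * (1 - bprob n psi q)) <=
    p * (1 - q) * (bprob n psi q * (1 - bprob n psi p)).
  move=> /IH[/ltW //|[c psic]|[j jn psij]].
    have E r : bprob n psi r = c%:R.
      by rewrite -[RHS](bexp_cst n c%:R r); apply: eq_bexp => b /psic ->.
    by rewrite !E; case: c {psic E}; rewrite ?(subrr,subr0,mulr0,mul0r).
  have E r : bprob n psi r = r.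
    rewrite -[RHS](bprob_dictator r jn).
    by apply: eq_bexp => b /psij ->.
  by rewrite !E le_eqVlt; apply/orP; left; apply/eqP; ring.
have le01 b : phi0 b -> phi1 b by apply: mphi => -[].
have a01 := bprob_le n p01' le01.
have /andP[a00 _] := bprob_itv n phi0 p01'.
have /andP[_ a11] := bprob_itv n phi1 p01'.
(* If the restrictions have equal probability they coincide, and the first bit
   is irrelevant. *)
have [eqa|neqa] := eqVneq (bprob n phi0 p) (bprob n phi1 p).
  have E := bprob_eq p01 le01 eqa.
  have Er r : bprob n.+1 phi r = bprob n phi0 r.
    rewrite bprobS (_ : bprob n (phi \o cons true) r = bprob n phi0 r).
      by rewrite /phi0; ring.
    by apply: eq_bexp => b /E ->.
  case: (IH _ m0) => [lt|[c hc]|[j jn hj]].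
  - by apply: Or31; rewrite !Er.
  - apply: Or32; exists c => -[//|[] b [bn]]; last exact: hc.
    by rewrite -(hc _ bn) (E _ bn).
  - apply: Or33; exists j.+1 => // -[//|[] b [bn]] /=; last exact: hj.
    by rewrite -(hj _ bn) (E _ bn).
have lta : bprob n phi0 p < bprob n phi1 p by rewrite lt_neqAle neqa.
have [nd|/negP] := boolP ((0 < bprob n phi0 p) || (bprob n phi1 p < 1)).
  apply: Or31; rewrite !bprobS.
  by apply: odds_mixture => //; [exact/orP|exact: weak|exact: weak].
(* Otherwise the restrictions are the constants false and true. *)
move=> /negP; rewrite negb_or -!leNgt => /andP[ha0 ha1].
apply: Or33; exists 0%N => // -[//|c b [bn]] /=.
have E0 : bprob n xpred0 p = bprob n phi0 p.
  by rewrite [LHS]bexp_cst; apply/le_anti; rewrite a00 ha0.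
have E1 : bprob n phi1 p = bprob n xpredT p.
  by rewrite [RHS]bexp_cst; apply/le_anti; rewrite a11 ha1.
case: c.
  exact: (bprob_eq p01 _ E1).
by symmetry; apply: (bprob_eq p01 _ E0).
Qed.

End bernoulli_bits.

(** * The event of a small statistic, and the module *)

Lemma natr_forall (R : realFieldType) (I : finType) (P c : pred I) :
  \prod_(i | P i) (c i)%:R = [forall (i | P i), c i]%:R :> R.
Proof.
have [/forallP h|] := boolP [forall (i | P i), c i].
  by rewrite big1// => i Pi; have /implyP/(_ Pi) -> := h i.
rewrite negb_forall => /existsP[i]; rewrite negb_imply => /andP[Pi /negPf ci].
by rewrite (bigD1 i)//= ci mul0r.
Qed.

Section hit.
Variable n : nat.
Implicit Type S : {set {set 'I_n}}.

(** When [b] records the bits [x_i <= t], this is the event that the statistic of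
    [x] is at most [t]. *)
Definition hit S : pred (seq bool) :=
  fun b => [forall (A | A \in S), [exists (i | i \in A), nth false b i]].

Lemma hitP S b : reflect
  (forall A : {set 'I_n}, A \in S -> exists2 i : 'I_n, i \in A & nth false b i)
  (hit S b).
Proof.
apply: (iffP forallP) => [h A AS|h A]; last first.
  by apply/implyP => /h[i iA bi]; apply/existsP; exists i; rewrite iA.
by have /implyP/(_ AS)/existsP[i /andP[iA bi]] := h A; exists i.
Qed.

Lemma monotone_hit S : monotone_bits (hit S).
Proof.
move=> b c bc /hitP h; apply/hitP => A /h[i iA /bc ci].
by exists i.
Qed.

Lemma hit_true S b : sperner_family S -> size b = n ->
  (forall i, (i < n)%N -> nth false b i) -> hit S b.
Proof.
move=> [_ S0 _] bn bT; apply/hitP => A AS.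
have /set0Pn[i iA] : A != finset.set0 by apply: contraNneq S0 => <-.
by exists i => //; apply: bT.
Qed.

Lemma hit_false S b : sperner_family S ->
  (forall i, (i < n)%N -> ~~ nth false b i) -> ~~ hit S b.
Proof.
move=> [/set0Pn[A AS] _ _] bF; apply/hitP => /(_ A AS)[i _].
exact/negP/bF.
Qed.

(** Inclusion-exclusion over the members of [S] missed by the set bits; a family
    [I] of members is missed when all bits in its union are unset, which has
    probability [(1 - t) ^ #|cover I|]. *)
Lemma sperner_moduleE (R : realType) S t :
  (sperner_module R S).[t] = bprob n (hit S) t.
Proof.
(* z C is the indicator that C is missed. *)
pose z (C : {set 'I_n}) (b : seq bool) : R :=
  [forall (i | i \in C), ~~ nth false b i]%:R.
have hitE b : (hit S b)%:R = \prod_(A in S) (1 - z A b).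
  rewrite /hit -natr_forall; apply: eq_bigr => A AS.
  rewrite /z -negb_exists_in.
  by case: [exists _ in _, _]; rewrite ?subr0 ?subrr.
have zU (I : {set {set 'I_n}}) b : \prod_(A in I) z A b = z (finset.cover I) b.
  rewrite /z natr_forall; congr (_%:R); congr (nat_of_bool _).
  apply/forallP/forallP => [h i|h A]; apply/implyP.
    by move=> /bigcupP[A AI iA]; have /implyP/(_ AI)/forallP/(_ i) := h A;
      rewrite iA.
  move=> AI; apply/forallP => i; apply/implyP => iA.
  by have /implyP := h i; apply; apply/bigcupP; exists A.
have zE C : bexp n (z C) t = (1 - t) ^+ #|C|.
  pose g (i : 'I_n) (c : bool) : R := if i \in C then (~~ c)%:R else 1.
  transitivity (bexp n (fun b => \prod_(i < n) g i (nth false b i)) t).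
    apply: eq_bexp => b _; rewrite /z -natr_forall big_mkcond /=.
    by apply: eq_bigr => i _; rewrite /g.
  rewrite bexp_prod -prodr_const [RHS]big_mkcond; apply: eq_bigr => i _ /=.
  by rewrite /g; case: ifP => _ /=; ring.
rewrite /sperner_module horner_sum.
transitivity (bexp n (fun b => \sum_(I : {set {set 'I_n}} | I \subset S)
    (-1) ^+ #|I| * z (finset.cover I) b) t).
  rewrite bexp_sum; apply: eq_bigr => I IS.
  by rewrite bexpZ zE !hornerE.
apply: eq_bexp => b _; rewrite hitE.
pose F (A : {set 'I_n}) := if A \in S then - z A b else 0.
transitivity (\prod_A (F A + 1)); last first.
  by rewrite [RHS]big_mkcond; apply: eq_bigr => A _; rewrite /F; case: ifP => _;
    rewrite ?add0r// addrC.
rewrite bigA_distr [LHS]big_mkcond; apply: eq_big => // I _.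
rewrite -[RHS]big_mkcond /=; case: ifPn => [/fintype.subsetP IS|].
  rewrite -zU -prodrN; apply: eq_bigr => A /IS AS.
  by rewrite /F AS.
move=> /fintype.subsetPn[A AI AS]; rewrite (bigD1 A)//= /F (negPf AS).
by rewrite mul0r.
Qed.

Lemma count_id_ge2 (b : seq bool) i j : (i < j)%N ->
  nth false b i -> nth false b j -> (2 <= count id b)%N.
Proof.
have cnt1 (c : seq bool) k : nth false c k -> (1 <= count id c)%N.
  move=> ck; rewrite -has_count; apply/hasP; exists true => //.
  rewrite -[true]ck mem_nth// ltnNge; apply: contraTN ck => /(nth_default _).
  by move=> ->.
elim: b i j => [|c b IH] [|i] [|j] //=.
  by move=> _ -> /cnt1; rewrite add1n ltnS.
by rewrite ltnS => ij bi bj; rewrite (leq_trans (IH _ _ ij bi bj))// leq_addl.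
Qed.

Lemma neq_count_id_ge2 (b : seq bool) (i j : 'I_n) : i != j ->
  nth false b i -> nth false b j -> (2 <= count id b)%N.
Proof.
rewrite -val_eqE neq_ltn => /orP[ij bi bj|ij bi bj].
  exact: count_id_ge2 ij bi bj.
exact: count_id_ge2 ij bj bi.
Qed.

(** A single set bit [i] would have to belong to every member of [S]. *)
Lemma hit_count S b : sperner_family S -> common_part S = finset.set0 ->
  hit S b -> (2 <= count id b)%N.
Proof.
move=> [/set0Pn[A AS] _ _] S0 /hitP h; have [i iA bi] := h A AS.
have : i \notin common_part S by rewrite S0 inE.
move=> /bigcapP/existsNP[B] /not_implyP[BS /negP iB].
have [j jB bj] := h B BS.
by apply: neq_count_id_ge2 bi bj; apply: contraNneq iB => ->.
Qed.

(** A missed member of [S] has at least two elements; [b] lists the unset bits. *)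
Lemma miss_count S b : sperner_family S -> ~~ has_singleton S -> size b = n ->
  ~~ hit S (map negb b) -> (2 <= count id b)%N.
Proof.
move=> [_ S0 _] S1 bn /hitP/existsNP[A] /not_implyP[AS nA].
have : (1 < #|A|)%N.
  have : #|A| != 0%N by rewrite cards_eq0; apply: contraNneq S0 => <-.
  have : #|A| != 1%N.
    by apply: contraNN S1 => A1; apply/existsP; exists A; rewrite AS.
  by case: #|A| => [|[]].
move=> /card_gt1P[i [j [iA jA ij]]].
have bA k : k \in A -> nth false b k.
  move=> kA; apply: contra_notT nA => bk; exists k => //.
  by rewrite (nth_map false) ?bn.
exact: neq_count_id_ge2 ij (bA _ iA) (bA _ jA).
Qed.

End hit.

(** * The Sperner statistic through bits *)

Section sperner_order.
Variables (R : realType) (n : nat).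
Implicit Types (S : {set {set 'I_n}}) (x : n.-tuple R).
Local Open Scope ereal_scope.

Lemma nth_map_tuple (T : Type) (c : T -> bool) (y : n.-tuple T) (i : 'I_n) :
  nth false (map c y) i = c (tnth y i).
Proof. by rewrite (nth_map (tnth y i)) ?size_tuple// -tnth_nth. Qed.

Lemma sperner_stat_le S x (t : R) : sperner_family S ->
  (sperner_stat S x <= t)%R = hit S (map (fun a => a <= t)%R x).
Proof.
move=> [/set0Pn[A0 A0S] S0 _].
pose m (A : {set 'I_n}) := \big[mine/+oo]_(i in A) (tnth x i)%:E.
pose M := \big[maxe/-oo]_(A in S) m A.
(* fine alters nothing because S and its members are nonempty. *)
have Mfin : M \is a fin_num.
  rewrite fin_numE -ltNye -ltey; apply/andP; split.
    apply: (@lt_le_trans _ _ (m A0)); last exact: le_bigmax_cond.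
    by apply/bigmin_gtP; split=> [|i _]; rewrite ltNye.
  apply/bigmax_ltP; split=> [|A AS]; first by rewrite ltey.
  have /set0Pn[i iA] : A != finset.set0 by apply: contraNneq S0 => <-.
  apply: (@le_lt_trans _ _ (tnth x i)%:E); last by rewrite ltey.
  exact: bigmin_le_cond.
rewrite -lee_fin fineK//.
apply/bigmax_leP/hitP => [[_ h] A AS|h].
  by have /bigmin_leP[//|[i iA]] := h A AS; rewrite lee_fin => it;
    exists i; rewrite ?nth_map_tuple.
split=> [|A /h[i iA]]; first by rewrite leNye.
by rewrite nth_map_tuple => it; apply/bigmin_leP; right; exists i;
  rewrite ?lee_fin.
Qed.

Lemma hit_not_constant S : sperner_family S -> ~ constant_on n (hit S).
Proof.
move=> hS [c hc].
have := hit_true hS (size_nseq n true); rewrite hc ?size_nseq// => cT.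
have := @hit_false _ _ (nseq n false) hS; rewrite hc ?size_nseq// => /(_ _)/negP.
apply; last by apply: cT => i iN; rewrite nth_nseq iN.
by move=> i iN; rewrite nth_nseq iN.
Qed.

(** A number is determined by the thresholds that it does not exceed. *)
Lemma hit_not_dictator S : sperner_family S ->
  ~ is_projection (@sperner_stat R n S) -> ~ dictator_on n (hit S).
Proof.
move=> hS; apply: contra_not => -[j jn hj]; exists (Ordinal jn) => x.
have E t : (sperner_stat S x <= t)%R = (tnth x (Ordinal jn) <= t)%R.
  rewrite sperner_stat_le// hj; last by rewrite size_map size_tuple.
  exact: (nth_map_tuple _ _ (Ordinal jn)).
by apply/le_anti; rewrite E lexx -E lexx.
Qed.

End sperner_order.

(** * The Sperner point separates the two regimes *)

Lemma itv01_neighbours (R : realFieldType) (x : R) : 0 < x < 1 ->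
  exists y z, [/\ 0 < y, y < x, x < z & z < 1].
Proof.
by case/andP=> x0 x1; exists (x / 2), ((x + 1) / 2); split; lra.
Qed.

Section sperner_fixed_point.
Variables (R : realType) (n : nat) (S : {set {set 'I_n}}).
Hypothesis hS : sperner_family S.
Hypothesis hH : ~ is_projection (@sperner_stat R n S).
Let h : R -> R := bprob n (hit S).

Lemma sperner_odds p q : 0 < p -> p < q -> q < 1 ->
  q * (1 - p) * (h p * (1 - h q)) < p * (1 - q) * (h q * (1 - h p)).
Proof.
move=> p0 pq q1.
case: (odds_increase n (@monotone_hit n S) p0 pq q1) => //.
  by move/(hit_not_constant hS).
by move/(hit_not_dictator hS hH).
Qed.

Lemma below_fixed_point p q : 0 < p -> p < q -> q < 1 -> h q = q -> h p < p.
Proof.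
move=> p0 pq q1 hq; have := sperner_odds p0 pq q1; rewrite hq => lt.
have : 0 < (1 - q) * q by nra.
by move: lt; nra.
Qed.

Lemma above_fixed_point p q : 0 < p -> p < q -> q < 1 -> h p = p -> q < h q.
Proof.
move=> p0 pq q1 hp; have := sperner_odds p0 pq q1; rewrite hp => lt.
have : 0 < (1 - p) * p by nra.
by move: lt; nra.
Qed.

(** The module is at most [2 ^ n * x ^ 2] near 0, hence below the diagonal, and
    symmetrically above it near 1; the intermediate value theorem does the rest.
    The point [2 ^ - (n + 1)] is where [2 ^ n * x ^ 2] equals [x / 2]. *)
Lemma sperner_fixed_point_exists :
  ~~ has_singleton S -> common_part S = finset.set0 ->
  exists w : R, 0 < w < 1 /\ (sperner_module R S).[w] = w.
Proof.
move=> S1 S0; pose x : R := (2 ^+ n.+1)^-1.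
have x0 : 0 < x by rewrite invr_gt0 exprn_gt0.
have x2 : x <= 2^-1.
  by rewrite lef_pV2 ?posrE ?exprn_gt0// exprS ler_peMr// exprn_ege1// ler1n.
have x1 : 0 <= x <= 1 by rewrite ltW//=; lra.
have xE : 2 ^+ n * x ^+ 2 = x / 2.
  rewrite expr2 mulrA mulrC; congr (_ * _).
  by rewrite /x exprS invfM mulrCA divff ?mulr1// expf_neq0.
have lo : h x < x.
  apply: (@le_lt_trans _ _ (2 ^+ n * x ^+ 2)); last by rewrite xE; lra.
  by apply: bprob_count => // b _; exact: hit_count.
have hi : 1 - x < h (1 - x).
  have := bprob_neg n (hit S) (1 - x); rewrite subKr => E.
  have : bprob n (fun b => ~~ hit S (map negb b)) x <= 2 ^+ n * x ^+ 2.
    by apply: bprob_count => // b; exact: miss_count.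
  by rewrite E xE /h; lra.
have [||w /andP[w0 w1]] := @poly_ivt R (sperner_module R S - 'X) x (1 - x).
- lra.
- by rewrite !hornerE !sperner_moduleE; apply/andP; split;
    rewrite /h in lo hi *; lra.
rewrite /root !hornerE subr_eq0 => /eqP wE; exists w; split=> //.
by apply/andP; split; lra.
Qed.

(** A family with a singleton [{j}] all of whose members contain [j] has the
    projection on the coordinate [j] as its statistic. *)
Lemma singleton_common : has_singleton S -> common_part S = finset.set0.
Proof.
move=> /exists_inP[A AS /cards1P[j Aj]]; apply/eqP/negPn/negP => /set0Pn[i].
move=> /bigcapP iS; apply: (hit_not_dictator hS hH).
have ij : i = j by have := iS A AS; rewrite Aj inE => /eqP.
exists (val j) => [|b _]; first exact: ltn_ord.
apply/hitP/idP => [/(_ A AS)[k]|bj B /iS].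
  by rewrite Aj inE => /eqP ->.
by rewrite ij => jB; exists j.
Qed.

(** With a singleton [{j}], [hit] implies the bit [j] and [h x <= x]; equality at
    one point would push [h] above the diagonal further right. The case of a
    common element is symmetric; otherwise [w] is an interior fixed point. *)
Lemma sperner_point_spec (w := sperner_point R S) :
  [/\ 0 <= w <= 1, forall x, 0 < x < w -> h x < x,
      forall x, w < x < 1 -> x < h x & 0 < w < 1 -> h w = w].
Proof.
rewrite /w /sperner_point; case: ifPn => [/andP[s1 _]|ns].
  rewrite lexx ler01; split => // [x x01|x|]; last 2 first.
  - by case/andP => /lt_trans /[apply]; rewrite ltxx.
  - by rewrite ltxx andbF.
  have lex y : 0 < y < 1 -> h y <= y.
    move=> /andP[y0 y1]; move/exists_inP: s1 => [A AS /cards1P[j Aj]].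
    rewrite -[leRHS](bprob_dictator y (ltn_ord j)).
    apply: bprob_le => [|b /hitP/(_ A AS)[k]]; first by rewrite !ltW.
    by rewrite Aj inE => /eqP ->.
  rewrite lt_neqAle lex// andbT; apply/eqP => hx.
  have [y [z [y0 yx xz z1]]] := itv01_neighbours x01; case/andP: x01 => x0 x1.
  have := above_fixed_point x0 xz z1 hx; rewrite ltNge lex//.
  by rewrite z1 (lt_trans x0).
case: ifPn => [/andP[s1 /set0Pn[j /bigcapP jS]]|nc].
  rewrite lexx ler01; split => // [x|x x01|]; last 2 first.
  - have gex y : 0 < y < 1 -> y <= h y.
      move=> /andP[y0 y1]; rewrite -[leLHS](bprob_dictator y (ltn_ord j)).
      apply: bprob_le => [|b bj]; first by rewrite !ltW.
      by apply/hitP => A /jS jA; exists j.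
    rewrite lt_neqAle gex// andbT eq_sym; apply/eqP => hx.
    have [y [z [y0 yx xz z1]]] := itv01_neighbours x01; case/andP: x01 => x0 x1.
    have := below_fixed_point y0 yx x1 hx; rewrite ltNge gex//.
    by rewrite y0 (lt_trans yx).
  - by rewrite ltxx.
  by case/andP => /lt_trans /[apply]; rewrite ltxx.
have s1 : ~~ has_singleton S.
  apply/negP => s1; move: ns; rewrite s1 /=; apply/negP/negPn/eqP.
  exact: singleton_common.
have s0 : common_part S = finset.set0.
  by move: nc; rewrite s1 /= negbK => /eqP.
have [/andP[w0 w1] hw] := getPex (sperner_fixed_point_exists s1 s0).
rewrite sperner_moduleE in hw; set v := get _ in w0 w1 hw *.
split=> // [|x /andP[x0 xv]|x /andP[vx x1]]; first by rewrite !ltW.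
- exact: below_fixed_point xv w1 hw.
- exact: above_fixed_point vx x1 hw.
Qed.

End sperner_fixed_point.

(** * Distribution functions of the iterates *)

Section sperner_law.
Local Open Scope ereal_scope.

(** Only finitely many bit patterns occur, and each of them is a finite
    intersection of conditions on single coordinates. *)
Lemma measurable_bits d (T : measurableType d) (c : T -> bool) n
    (phi : pred (seq bool)) : measurable [set a | c a] ->
  measurable [set x : n.-tuple T | phi (map c x)].
Proof.
move=> mc.
rewrite (_ : [set x | _] = \bigcup_(b in [set b : n.-tuple bool | phi b])
  \bigcap_(i in [set: 'I_n]) (fun x : n.-tuple T => tnth x i) @^-1`
    [set a | c a = tnth b i]); last first.
  apply/seteqP; split=> [x /= phix|x [b /= phib xb]].
    by exists (map_tuple c x) => // i _ /=; rewrite tnth_map.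
  rewrite (_ : map c x = b)//.
  by apply: (congr1 val (_ : map_tuple c x = b)); apply: eq_from_tnth => i;
    rewrite tnth_map xb.
apply: fin_bigcup_measurable => // b _; apply: fin_bigcap_measurable => // i _.
rewrite -[X in measurable X]setTI; apply: measurable_tnth => //.
case: (tnth b i) => //.
rewrite (_ : [set a | _] = ~` [set a | c a]); first exact: measurableC.
by apply/seteqP; split=> a /=; [move=> ->|move/negP/negPf].
Qed.

(** Splitting the event according to the first coordinate gives two disjoint
    rectangles, which is the recursion of [bprob]. *)
Lemma iid_law_bits (R : realType) d (T : measurableType d)
    (mu : probability T R) (c : T -> bool) n (phi : pred (seq bool)) :
  measurable [set a | c a] ->
  iid_law mu n [set x | phi (map c x)] =
  (bprob n phi (fine (mu [set a | c a])))%:E.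
Proof.
move=> mc; elim: n phi => [|n IH] phi.
  rewrite /= diracE /bprob /=; congr (_%:R%:E); congr (nat_of_bool _).
  by apply/idP/idP => [/set_mem|h]; last apply/mem_set.
pose C := [set a | c a]; pose D b := [set y : n.-tuple T | phi (b :: map c y)].
have mD b : measurable (D b)
  by exact: (@measurable_bits _ _ c n (phi \o cons b) mc).
have mnC : measurable (~` C) by exact: measurableC.
rewrite /= /distribution /pushforward.
rewrite (_ : _ @^-1` _ = (C `*` D true) `|` (~` C `*` D false)); last first.
  apply/seteqP; split=> [[a y] /=|[a y] /= [[]|[]]]; rewrite /C /D /=.
  - by case E: (c a) => h; [left|right].
  - by move=> ->.
  - by move=> /negP/negPf ->.
have muC : mu C = (fine (mu C))%:E by rewrite fineK// fin_num_measure.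
rewrite measureU; [|exact: measurableX|exact: measurableX|]; last first.
  by apply/seteqP; split=> [[a y] /= [[Ca _] []]|].
transitivity (mu C * iid_law mu n (D true) + mu (~` C) * iid_law mu n (D false)).
  by congr (_ + _); exact: product_measure1E.
rewrite probability_setC// muC.
by rewrite (IH (phi \o cons true)) (IH (phi \o cons false)).
Qed.

End sperner_law.

(** * Dynamics of the module on the unit interval *)

Section iteration.
Variable R : realType.

Lemma bprob_bool n (phi : pred (seq bool)) (c : bool) :
  bprob n phi c%:R = (phi (nseq n c))%:R :> R.
Proof.
elim: n phi => [//|n IH] phi; rewrite bprobS !IH.
by case: c {IH}; rewrite /= ?subrr ?subr0 ?mul0r ?mul1r ?addr0 ?add0r.
Qed.

(** The iterates decrease, and by continuity their limit is a fixed point in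
    [[0, p]], where 0 is the only one. *)
Lemma iter_cvg0 (h : {poly R}) (p : R) : 0 <= p ->
  (forall x : R, 0 <= x <= p -> 0 <= h.[x]) -> h.[0] = 0 ->
  (forall x : R, 0 < x <= p -> h.[x] < x) ->
  iter N (horner h) p @[N --> \oo] --> (0 : R).
Proof.
move=> p0 h0 h00 hlt; pose u N := iter N (horner h) p.
have hle (x : R) : 0 <= x <= p -> h.[x] <= x.
  move=> /andP[]; rewrite le_eqVlt => /predU1P[<-|x0 xp]; first by rewrite h00.
  by rewrite ltW// hlt// x0.
have uI N : 0 <= u N <= p.
  elim: N => [|N IH]; first by rewrite p0 lexx.
  case/andP: (IH) => u0 up; apply/andP; split; first exact: h0 IH.
  exact: le_trans (hle _ IH) up.
have ucvg : cvgn u.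
  apply: nonincreasing_is_cvgn.
    by apply/nonincreasing_seqP => N; exact: hle.
  by exists 0 => _ [N _ <-]; case/andP: (uI N).
have ulim : limn u = h.[limn u].
  apply: (@cvg_lim _ _ _ (u @ \oo)) => //.
  rewrite -cvg_shiftS.
  rewrite (_ : (fun N => u N.+1) = horner h \o u)//.
  by apply: continuous_cvg; [exact: continuous_horner|exact: ucvg].
have l0 : 0 <= limn u
  by apply: limr_ge => //; apply: nearW => N; case/andP: (uI N).
have lp : limn u <= p
  by apply: limr_le => //; apply: nearW => N; case/andP: (uI N).
suff <- : limn u = 0 by exact: ucvg.
apply/eqP; apply: contraTT isT => l_neq0.
have : h.[limn u] < limn u by apply: hlt; rewrite lt_neqAle eq_sym l_neq0 l0.
by rewrite -ulim ltxx.
Qed.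

(** Conjugation by [x |-> 1 - x] exchanges the fixed points 0 and 1. *)
Lemma iter_cvg1 (h : {poly R}) (p : R) : p <= 1 ->
  (forall x : R, p <= x <= 1 -> h.[x] <= 1) -> h.[1] = 1 ->
  (forall x : R, p <= x < 1 -> x < h.[x]) ->
  iter N (horner h) p @[N --> \oo] --> (1 : R).
Proof.
move=> p1 h1 h11 hgt; pose g := 1 - h \Po (1 - 'X).
have gE x : g.[x] = 1 - h.[1 - x] by rewrite /g !(hornerE, horner_comp).
have E : (fun N => iter N (horner h) p) =
    (fun N => 1 - iter N (horner g) (1 - p)).
  apply/funext; elim=> [|N IH] /=; first by rewrite subKr.
  by rewrite gE subKr -IH.
rewrite E -[X in _ --> X]subr0; apply: cvgB; first exact: cvg_cst.
apply: iter_cvg0 => [|x x01||x x01]; rewrite ?subr_ge0// gE.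
- by rewrite subr_ge0; apply: h1; lra.
- by rewrite subr0 h11 subrr.
- by have := hgt (1 - x); move: x01; lra.
Qed.

End iteration.

Section sperner_iteration.
Variables (R : realType) (n : nat) (S : {set {set 'I_n}}).
Hypothesis hS : sperner_family S.
Let h := sperner_module R S.

Lemma sperner_iterE N (mu : probability R R) t :
  sperner_iter S N mu `]-oo, t]%classic =
  (iter N (horner h) (fine (mu `]-oo, t]%classic)))%:E.
Proof.
elim: N => [|N IH]; first by rewrite fineK// fin_num_measure.
transitivity (iid_law (sperner_iter S N mu) n
    [set x | hit S (map (fun a => a <= t) x)]).
  congr (iid_law _ n _).
  by apply/seteqP; split=> x /=; rewrite in_itv /= sperner_stat_le.
rewrite iid_law_bits -?set_itvNyc; last exact: measurable_itv.
by rewrite IH -sperner_moduleE.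
Qed.

Hypothesis hH : ~ is_projection (@sperner_stat R n S).
Let w := sperner_point R S.

Lemma iter_module_cvg (p : R) : 0 <= p <= 1 ->
  iter N (horner h) p @[N --> \oo] -->
    (if p < w then 0 else if w < p then 1 else w : R).
Proof.
move=> /andP[p0 p1].
have [/andP[w0 w1] hlt hgt hw] := sperner_point_spec hS hH.
rewrite -/w in w0 w1 hlt hgt hw.
have h0 : h.[0] = 0.
  rewrite sperner_moduleE -[0]/(false%:R) bprob_bool (negPf (hit_false _ _))//.
  by move=> i iN; rewrite nth_nseq iN.
have h1 : h.[1] = 1.
  rewrite sperner_moduleE -[1]/(true%:R) bprob_bool hit_true// ?size_nseq//.
  by move=> i iN; rewrite nth_nseq iN.
have h01 x : 0 <= x <= 1 -> 0 <= h.[x] <= 1.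
  by rewrite sperner_moduleE; exact: bprob_itv.
case: ltgtP => [pw|wp|->].
- apply: iter_cvg0 => // [x /andP[x0 xp]|x /andP[x0 xp]].
    by have /h01/andP[] : 0 <= x <= 1 by rewrite x0 (le_trans xp).
  by rewrite sperner_moduleE; apply: hlt; rewrite x0 (le_lt_trans xp).
- apply: iter_cvg1 => // [x /andP[px x1]|x /andP[px x1]].
    by have /h01/andP[] : 0 <= x <= 1 by rewrite x1 (le_trans _ px).
  by rewrite sperner_moduleE; apply: hgt; rewrite x1 andbT (lt_le_trans wp).
have hww : h.[w] = w.
  move: w0; rewrite le_eqVlt => /predU1P[<- //|w0].
  move: w1; rewrite le_eqVlt => /predU1P[-> //|w1].
  by rewrite sperner_moduleE hw// w0.
rewrite (_ : (fun N => _) = cst w); first exact: cvg_cst.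
by apply/funext; elim=> //= N ->.
Qed.

End sperner_iteration.

(** * The distribution function of the quantile variable *)

Section quantile_law.
Context {R : realType}.
Local Open Scope ereal_scope.

(** An atom at [t] separates the value at [t] from all values to its left. *)
Lemma continuous_ext_cdf_atom (nu : probability (\bar R) R) (t : R) :
  {for t, continuous (ext_cdf nu)} -> nu [set t%:E] = 0.
Proof.
move=> ct; have m1 : measurable [set t%:E : \bar R] by exact: emeasurable_set1.
have mle (s : R) : measurable [set y : \bar R | y <= s%:E].
  by rewrite -set_itvNyc; exact: emeasurable_itv.
have nu_fin A : measurable A -> nu A \is a fin_num by exact: fin_num_measure.
have left : \forall s \near t^'-, ext_cdf nu s <= ext_cdf nu t - nu [set t%:E].
  near=> s; have st : (s < t)%R by near: s; exact: nbhs_left_lt.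
  rewrite leeBrDr ?nu_fin// /ext_cdf -measureU//.
    apply: le_measure; rewrite ?inE//; first exact: measurableU.
    move=> y /= [ys|->]; last exact: lexx.
    apply: le_trans ys _.
    by rewrite lee_fin ltW.
  by apply/seteqP; split=> // y [/= + yt]; rewrite yt lee_fin leNgt st.
have := cvge_to_le (cvg_at_left_filter ct) left.
rewrite leeBrDr ?nu_fin// -[leRHS]adde0 leeD2lE ?nu_fin// => le0.
by apply/le_anti; rewrite le0 measure_ge0.
Unshelve. all: by end_near. Qed.

Context {d : measure_display} {T : measurableType d} {P : probability T R}.
Variables (X : {RV P >-> R}) (w : R).
Hypothesis w01 : (0 <= w <= 1)%R.

Lemma quantile_lawE (A : set (\bar R)) : quantile_law X w A =
  (w * (quantile_var X w true \in A)%:R +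
   (1 - w) * (quantile_var X w false \in A)%:R)%:E.
Proof.
transitivity (bernoulli_prob w (quantile_var X w @^-1` A)) => //.
by rewrite bernoulli_probE// !diracE.
Qed.

(** Continuity at [t] rules out that [t] is one of the values that [Q_X(w)] takes
    with positive probability, so that comparing such a value with [t] amounts to
    comparing [F] with [w]. *)
Lemma ext_cdf_quantile (t : R) :
  {for t, continuous (ext_cdf (quantile_law X w))} ->
  let F := fine (cdf X t) in
  ext_cdf (quantile_law X w) t =
    (if F < w then 0 else if w < F then 1 else w)%R%:E.
Proof.
move=> /continuous_ext_cdf_atom; rewrite quantile_lawE => -[] atom F.
have FE : cdf X t = F%:E by rewrite fineK// fin_num_measure.
have [F0 F1] : (0 <= F /\ F <= 1)%R.
  by rewrite -!lee_fin -FE; split; [exact: cdf_ge0|exact: cdf_le1].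
have mono (s : R) : s%:E < t%:E -> cdf X s <= cdf X t.
  by rewrite lte_fin => /ltW; exact: cdf_nondecreasing.
have mono' (s : R) : t%:E < s%:E -> cdf X t <= cdf X s.
  by rewrite lte_fin => /ltW; exact: cdf_nondecreasing.
case/andP: w01 => w0 w1.
have inle y : (y \in [set y : \bar R | y <= t%:E]) = (y <= t%:E).
  by apply/idP/idP; rewrite inE.
have inat y : (y \in [set t%:E]) = (y == t%:E).
  by apply/idP/eqP; rewrite inE.
rewrite /ext_cdf quantile_lawE !inle; congr (_%:E).
rewrite !inat in atom.
move: atom; rewrite /quantile_var.
have [w0'|w_neq0] := eqVneq w 0%R.
  rewrite w0' !mul0r subr0 !mul1r !add0r.
  have [lt _|gt _|_] := ltgtP (ess_infimum X) t%:E.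
  - have /ereal_inf_lt[_ [s /= cs <-] st] := lt.
    have : (0 < F)%R by rewrite -lte_fin -FE (lt_le_trans cs)// mono.
    by move=> F0'; rewrite F0' ltNge F0.
  - have : ~~ (0 < F)%R.
      rewrite -lte_fin -FE; apply: contraTN gt => c0; rewrite -leNgt.
      by apply: ereal_inf_lbound; exists t.
    by move=> /negPf ->; rewrite if_same.
  - by move=> /eqP; rewrite oner_eq0.
have [w1'|w_neq1] := eqVneq w 1%R.
  rewrite w1' subrr !mul0r !addr0 !mul1r.
  have [lt _|gt _|_] := ltgtP (ess_supremum X) t%:E.
  - have : ~~ (F < 1)%R.
      rewrite -lte_fin -FE; apply: contraTN lt => c1; rewrite -leNgt.
      by apply: ereal_sup_ubound; exists t.
    by move=> /negPf ->; rewrite if_same.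
  - have /ereal_sup_gt[_ [s /= cs <-] st] := gt.
    have : (F < 1)%R by rewrite -lte_fin -FE (le_lt_trans _ cs)// mono'.
    by move=> ->.
  - by move=> /eqP; rewrite oner_eq0.
have {}w0 : (0 < w)%R by rewrite lt_neqAle eq_sym w_neq0.
have {}w1 : (w < 1)%R by rewrite lt_neqAle w_neq1.
set a := lower_quantile X w; set z := upper_quantile X w => atom.
have neq (y : \bar R) (c : R) :
    (0 < c)%R -> (c * (y == t%:E)%:R = 0)%R -> y != t%:E.
  by move=> c0; case: eqP => // _; rewrite mulr1 => /eqP; rewrite gt_eqF.
have [atom_a atom_z] : (w * (a == t%:E)%:R = 0)%R /\
    ((1 - w) * (z == t%:E)%:R = 0)%R.
  by move: atom; do 2 case: (_ == _); rewrite ?mulr0 ?mulr1; split; lra.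
have a_neq := neq _ _ w0 atom_a.
have z_neq : z != t%:E by apply: neq atom_z; rewrite subr_gt0.
have az : a <= z.
  by apply: le_ereal_inf => _ [s /= ws <-]; exists s => //=; exact: ltW.
have aE : (a <= t%:E) = (w <= F)%R.
  rewrite -lee_fin -FE; apply/idP/idP => [|c];
    last by apply: ereal_inf_lbound; exists t.
  rewrite le_eqVlt (negPf a_neq) /= => /ereal_inf_lt[_ [s /= cs <-] st].
  by rewrite (le_trans cs)// mono.
have zE : (z <= t%:E) = (w < F)%R.
  rewrite -lte_fin -FE; apply/idP/idP => [|c];
    last by apply: ereal_inf_lbound; exists t.
  rewrite le_eqVlt (negPf z_neq) /= => /ereal_inf_lt[_ [s /= cs <-] st].
  by rewrite (lt_le_trans cs)// mono.
rewrite aE zE.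
by case: ltgtP => _; rewrite ?mulr0 ?mulr1 ?addr0//; lra.
Qed.

End quantile_law.

Theorem theorem7p1 (R : realType) (n : nat) (hn : (1 <= n)%N)
    (S : {set {set 'I_n}}) (hS : sperner_family S)
    (hH : ~ is_projection (@sperner_stat R n S))
    (d : measure_display) (T : measurableType d) (P : probability T R)
    (X : {RV P >-> R}) :
  cvg_in_distribution (fun N => sperner_iter S N (distribution P X))
    (quantile_law X (sperner_point R S)).
Proof.
move=> t ct.
have [w01 _ _ _] := sperner_point_spec hS hH.
rewrite ext_cdf_quantile//.
under eq_fun do rewrite sperner_iterE//.
apply: cvg_EFin; first exact: nearW.
apply: iter_module_cvg => //.
have := @cdf_le1 _ _ _ _ X t; have := @cdf_ge0 _ _ _ _ X t.
by rewrite -[cdf X t]fineK ?fin_num_measure// !lee_fin => -> ->.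
Qed.
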